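(* Let $q_\varepsilon(t)$ be a space change of the trajectory $t\mapsto q(t)$, $t\in I$, and $\tau(\varepsilon,t)$ a time change. Suppose that there is infinitesimal invariance under space and time change for $(q_\varepsilon,\tau)$, and that $t\mapsto q(t)$ is a solution to the Lagrange equation. Then the following function is constant on $I$: $$t\mapsto\partial_{\dot q}L\bigl(t,q(t),\dot q(t)\bigr)\cdot\partial_\varepsilon q_\varepsilon(t)|_{\varepsilon=0}+L\bigl(t,q(t),\dot q(t)\bigr)\,\partial_\varepsilon\tau(\varepsilon,t)|_{\varepsilon=0}.$$
   Context: Let $n\ge1$ and let $L=L(t,q,\dot q)$ (the Lagrangian) be a smooth real-valued function on an open subset of $\mathbb{R}\times\mathbb{R}^n\times\mathbb{R}^n$. The symbols $\partial_qL,\partial_{\dot q}L$ denote the gradients with respect to the second and third arguments, viewed as vectors of $\mathbb{R}^n$; $x\cdot y$ is the Euclidean inner product; a dot over a function denotes the derivative in $t$. Let $t\mapsto q(t)\in\mathbb{R}^n$ be a smooth trajectory on an open interval $I$ such that $(t,q(t),\dot q(t))$ lies in the domain of $L$ for all $t\in I$. It is a solution to the Lagrange equation if $\frac{d}{dt}\partial_{\dot q}L(t,q(t),\dot q(t))-\partial_qL(t,q(t),\dot q(t))=0$ for all $t\in I$. All functions of $(\varepsilon,t)$ below are defined on an open neighbourhood of $\{0\}\times I$ in $\mathbb{R}\times I$ (i.e. for $t\in I$ and $\varepsilon$ close to $0$). A space change of $q$ is a smooth one-parameter family $(\varepsilon,t)\mapsto q_\varepsilon(t)\in\mathbb{R}^n$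 with $q_0(t)=q(t)$ for all $t\in I$. A time change is a smooth real function $\tau(\varepsilon,t)$ with $\tau(0,t)=t$ for all $t\in I$. The Hamiltonian action is $A_{a,b}(q)=\int_a^bL(t,q(t),\dot q(t))\,dt$. Infinitesimal invariance under space and time change for $(q_\varepsilon,\tau)$ means $$\frac{\partial A_{\tau(\varepsilon,a),\tau(\varepsilon,b)}(q_\varepsilon)}{\partial\varepsilon}\Big|_{\varepsilon=0}=0\quad\forall a,b\in I,$$ equivalently $$\frac{\partial}{\partial\varepsilon}\Bigl(L\bigl(\tau(\varepsilon,t),q_\varepsilon(\tau(\varepsilon,t)),\dot q_\varepsilon(\tau(\varepsilon,t))\bigr)\partial_t\tau(\varepsilon,t)\Bigr)\Big|_{\varepsilon=0}=0\quad\forall t\in I .$$ *)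

(* Defs.v *)
From HB Require Import structures.
From mathcomp Require Import all_boot all_order all_algebra.
From mathcomp Require Import all_classical all_reals all_analysis.
Set Implicit Arguments.
Unset Strict Implicit.
Unset Printing Implicit Defensive.
Import Order.TTheory GRing.Theory Num.Theory.
Import numFieldNormedType.Exports.
Local Open Scope ring_scope.
Local Open Scope classical_set_scope.

(* All functions are total; only their values on the stated (open) domains are
   constrained. *)

(* [Ck k U f]: [f] is of class C^k on [U].  This is the usual notion for [U]
   open and [V] finite-dimensional, the only case in which it is used:
   C^(k+1) means differentiable on [U] with all directional derivatives
   of class C^k. *)
Fixpoint Ck (R : realType) (V W : normedModType R) (k : nat) (U : set V)
    (f : V -> W) : Prop :=
  match k with
  | 0 => forall x, U x -> {for x, continuous f}
  | k'.+1 => (forall x, U x -> differentiable f x) /\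
             (forall v, Ck k' U (fun x => 'D_v f x))
  end.

Definition smooth_on (R : realType) (V W : normedModType R) (U : set V)
    (f : V -> W) : Prop := forall k, Ck k U f.

Definition dotr (R : realType) (n : nat) (x y : 'rV[R]_n) : R :=
  \sum_(i < n) x 0 i * y 0 i.

Definition gradient (R : realType) (n : nat) (f : 'rV[R]_n -> R)
    (x : 'rV[R]_n) : 'rV[R]_n :=
  \row_(i < n) 'D_(delta_mx 0 i) f x.

Definition grad_pos (R : realType) (n : nat)
    (L : R -> 'rV[R]_n -> 'rV[R]_n -> R) (t : R) (x v : 'rV[R]_n) : 'rV[R]_n :=
  gradient (fun y => L t y v) x.

Definition grad_vel (R : realType) (n : nat)
    (L : R -> 'rV[R]_n -> 'rV[R]_n -> R) (t : R) (x v : 'rV[R]_n) : 'rV[R]_n :=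
  gradient (fun w => L t x w) v.

Definition is_lagrangian (R : realType) (n : nat)
    (U : set (R * 'rV[R]_n * 'rV[R]_n))
    (L : R -> 'rV[R]_n -> 'rV[R]_n -> R) : Prop :=
  open U /\
  smooth_on U (fun z : R * 'rV[R]_n * 'rV[R]_n => L z.1.1 z.1.2 z.2).

Definition open_interval (R : realType) (I : set R) : Prop :=
  open I /\ is_interval I.

Definition is_trajectory (R : realType) (n : nat)
    (U : set (R * 'rV[R]_n * 'rV[R]_n)) (I : set R) (q : R -> 'rV[R]_n) :
    Prop :=
  smooth_on I q /\ forall t, I t -> U (t, q t, derive1 q t).

Definition lagrange_solution (R : realType) (n : nat)
    (L : R -> 'rV[R]_n -> 'rV[R]_n -> R) (I : set R) (q : R -> 'rV[R]_n) :
    Prop :=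
  forall t, I t ->
    derive1 (fun s => grad_vel L s (q s) (derive1 q s)) t
      - grad_pos L t (q t) (derive1 q t) = 0.

Definition smooth_family (R : realType) (W : normedModType R) (I : set R)
    (F : R -> R -> W) : Prop :=
  exists D : set (R * R),
    [/\ open D,
        forall t, I t -> D (0, t),
        forall e t, D (e, t) -> I t &
        smooth_on D (fun z : R * R => F z.1 z.2)].

Definition space_change (R : realType) (n : nat) (I : set R)
    (q : R -> 'rV[R]_n) (Q : R -> R -> 'rV[R]_n) : Prop :=
  smooth_family I Q /\ forall t, I t -> Q 0 t = q t.

Definition time_change (R : realType) (I : set R) (tau : R -> R -> R) : Prop :=
  smooth_family I tau /\ forall t, I t -> tau 0 t = t.

(* The integral is oriented: the endpoints [tau e a], [tau e b] of the action
   may come in either order. *)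
Definition oriented_integral (R : realType) (a b : R) (f : R -> R) : R :=
  if a <= b then \int[lebesgue_measure]_(t in `[a, b]) f t
  else - \int[lebesgue_measure]_(t in `[b, a]) f t.

Definition action (R : realType) (n : nat)
    (L : R -> 'rV[R]_n -> 'rV[R]_n -> R) (a b : R) (q : R -> 'rV[R]_n) : R :=
  oriented_integral a b (fun t => L t (q t) (derive1 q t)).

(* For fixed [a], [b] in [I] and [e] close to 0, the segment between [tau e a]
   and [tau e b] lies in [I] and the integrand only involves points of the
   domains of [L] and [Q], so the junk values elsewhere play no role. *)
Definition infinitesimal_invariance (R : realType) (n : nat)
    (L : R -> 'rV[R]_n -> 'rV[R]_n -> R) (I : set R)
    (Q : R -> R -> 'rV[R]_n) (tau : R -> R -> R) : Prop :=
  forall a b, I a -> I b ->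
    is_derive (0 : R) (1 : R)
      (fun e => action L (tau e a) (tau e b) (Q e)) (0 : R).

(* Main.v *)
Require Import Defs.
From mathcomp Require Import all_boot all_order all_algebra.
From mathcomp Require Import all_classical all_reals all_analysis.
From mathcomp Require Import ring lra.
Import Order.TTheory GRing.Theory Num.Theory.
Import numFieldNormedType.Exports.
Local Open Scope ring_scope.
Local Open Scope classical_set_scope.

(** Let [F (e, s)] be the Lagrangian evaluated along the varied trajectory
    [Q e] at time [s], and [T (e, t)] the time change. It is enough to show
    that the conserved quantity [h] has derivative 0 at each [t0] of the
    interval.

    Fix [t0] and let [A e x] be the action of [Q e] between the times
    [T (e, t0)] and [T (e, x)]. Invariance says that the derivative of [A] in
    [e] at [e = 0] vanishes for all [x] in the interval. By the fundamental
    theorem of calculus the derivative of [A] in [x] is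
    [k (e, x) = F (e, T (e, x)) * d_x T (e, x)], a function of class C^1.
    Taking the two derivatives in the other order, the derivative in [e] of
    [k] at [(0, t0)] vanishes, that is
<<
    d_e F + d_s F * d_e T + F * d_e d_s T = 0     at (0, t0).
>>
    This is [invariance_density]: it passes from the integral form of the
    invariance to the pointwise one without differentiating under the integral
    sign. The exchange of the derivatives is [derive_along_mixed], an estimate
    of the second difference of [A] by two applications of the mean value
    theorem; the same lemma shows that mixed partial derivatives of [Q] and
    [T] commute ([is_derive_mixed_partials]).

    At [(0, t0)], the chain rule for the Lagrangian ([diff_lagrangian]) turns
    [d_e F] into [d_q L . d_e Q + d_v L . d_e d_s Q]. The Lagrange equation
    replaces [d_q L] by the time derivative of [d_v L], and commuting partial
    derivatives replaces [d_e d_s Q] and [d_e d_s T] by the time derivatives of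
    [d_e Q] and [d_e T]. The identity then reads
    [(d_v L . d_e Q + L * d_e T)' = 0] by the product rule, which is
    [h' = 0]. *)

Set Implicit Arguments.
Unset Strict Implicit.

(** * Mean value estimates and the exchange of derivatives *)

Lemma mean_value_bound (R : realType) (f df : R -> R) (a r M : R) :
  (forall x, `|x - a| < r -> is_derive x 1 f (df x)) ->
  (forall x, `|x - a| < r -> `|df x| <= M) ->
  forall b, `|b - a| < r -> `|f b - f a| <= M * `|b - a|.
Proof.
move=> fdf dfM b bar.
have r0 : 0 < r by exact: le_lt_trans (normr_ge0 _) bar.
have cf x : `|x - a| < r -> {for x, continuous f}.
  move=> /fdf [fx _]; apply/differentiable_continuous.
  exact/derivable1_diffP.
have seg u v : `|u - a| < r -> `|v - a| < r -> u <= v ->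
    `|f v - f u| <= M * `|v - u|.
  move=> ur vr uv.
  have sub x : x \in `[u, v]%R -> `|x - a| < r.
    by rewrite in_itv/= => /andP[ux xv]; move: ur vr; rewrite !ltr_norml; lra.
  have [||c cuv ->] := @MVT_segment R f df u v uv.
  - by move=> x xuv; apply: fdf; apply: sub; exact: subset_itv_oo_cc xuv.
  - by apply: continuous_in_subspaceT => x; rewrite inE/= => /sub; exact: cf.
  - by rewrite normrM ler_wpM2r//; apply/dfM/sub.
have [ab|ba] := leP a b; first by apply: seg; rewrite ?subrr ?normr0.
rewrite distrC (distrC b).
by apply: seg; rewrite ?subrr ?normr0 ?ltW.
Qed.

Lemma constant_of_derive0 (R : realType) (I : set R) (h : R -> R) :
  is_interval I -> (forall t, I t -> is_derive t 1 h 0) ->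
  exists c, forall t, I t -> h t = c.
Proof.
move=> itvI dh.
have eqh a b : I a -> I b -> a <= b -> h a = h b.
  move=> Ia Ib ab.
  have sub x : x \in `[a, b]%R -> I x.
    by rewrite in_itv/= => xab; exact: itvI xab.
  have [||c _] := @MVT_segment R h (cst 0) a b ab.
  - by move=> x xab; apply: dh; apply: sub; exact: subset_itv_oo_cc xab.
  - apply: continuous_in_subspaceT => x; rewrite inE/= => /sub/dh [hx _].
    by apply/differentiable_continuous/derivable1_diffP.
  - by rewrite mul0r => /eqP; rewrite subr_eq0 => /eqP ->.
have [[a Ia]|noI] := pselect (exists a, I a); last first.
  by exists 0 => t It; case: noI; exists t.
exists (h a) => t It; have [at_|/ltW ta] := leP a t; last exact: eqh.
by rewrite (eqh a t).
Qed.

(** If [k] is the derivative of [N] in the second variable, [K] that of [k] in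
    the first one, and [h] that of [N] in the first variable along [e = 0],
    two mean value estimates and the continuity of [K] show that the second
    difference [N e x - N 0 x - (N e t0 - N 0 t0)] is
    [e * (x - t0) * (K 0 t0 + o(1))]. Dividing by [e] and letting [e] tend to 0
    gives the increment [h x - h t0]. *)
Lemma derive_along_mixed (R : realType) (N k K : R -> R -> R) (h : R -> R)
    (t0 : R) :
  (\forall e \near (0 : R) & x \near t0, is_derive (x : R) 1 (N e) (k e x)) ->
  (\forall e \near (0 : R) & x \near t0, is_derive (e : R) 1 (k^~ x) (K e x)) ->
  {for ((0 : R), t0), continuous (fun z : R * R => K z.1 z.2)} ->
  (\forall x \near t0, is_derive (0 : R) 1 (N^~ x) (h x)) ->
  is_derive t0 1 h (K 0 t0).
Proof.
move=> dN dk cK dh.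
suff lim_h : (fun d : R => d^-1 *: (h (d *: 1 + t0) - h t0)) @ 0^'
    --> K 0 t0.
  by split; [apply/cvg_ex; exists (K 0 t0) | exact/cvg_lim].
apply/cvgrPdist_le => /= eta eta0.
have /cvgrPdist_lt /(_ _ eta0) /= nK := cK.
have [r /= r0 box] : exists2 r, 0 < r & forall e x, `|e| < r ->
    `|x - t0| < r -> [/\ is_derive x 1 (N e) (k e x),
      is_derive e 1 (k^~ x) (K e x), `|K e x - K 0 t0| <= eta &
      is_derive (0 : R) 1 (N^~ x) (h x)].
  have /nbhs_ballP[r1 /= r10 hr1] : nbhs ((0 : R), t0) (fun z : R * R =>
      [/\ is_derive z.2 1 (N z.1) (k z.1 z.2),
          is_derive z.1 1 (k^~ z.2) (K z.1 z.2) &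
          `|K 0 t0 - K z.1 z.2| < eta]).
    by near=> z; split; near: z.
  have /nbhs_ballP[r2 /= r20 hr2] := dh.
  exists (Num.min r1 r2); first by rewrite lt_min r10.
  move=> e x; rewrite !lt_min => /andP[er1 er2] /andP[xr1 xr2].
  have [] := hr1 (e, x).
    by split; rewrite /ball/= ?sub0r ?normrN// distrC.
  move=> ? ? /ltW ?; split => //; first by rewrite distrC.
  by apply: hr2; rewrite /ball/= distrC.
have second_difference e x : `|e| < r -> `|x - t0| < r ->
    `|N e x - N 0 x - (N e t0 - N 0 t0) - e * (x - t0) * K 0 t0|
      <= eta * `|e| * `|x - t0|.
  move=> er xr.
  (* The linear correction turns the target into an increment of [g], and the
     derivative of [g] into an increment of [g2] below. *)
  pose g y := N e y - N 0 y - e * K 0 t0 * y.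
  have dg y : `|y - t0| < r ->
      is_derive y 1 g (k e y - k 0 y - e * K 0 t0).
    move=> yr; have [d1 _ _ _] := box e y er yr.
    have [d2 _ _ _] := box 0 y ltac:(by rewrite normr0) yr.
    have d3 : is_derive y 1 ((e * K 0 t0) \*: @id R) (e * K 0 t0).
      by apply: is_derive_eq; rewrite /GRing.scale /= mulr1.
    exact: is_deriveB (is_deriveB d1 d2) d3.
  have bg y : `|y - t0| < r ->
      `|k e y - k 0 y - e * K 0 t0| <= eta * `|e|.
    move=> yr.
    pose g2 s := k s y - K 0 t0 * s.
    have := @mean_value_bound R g2 (fun s => K s y - K 0 t0) 0 r eta _ _ e.
    rewrite /g2 !subr0 mulr0 subr0 => H.
    rewrite [X in `|X|](_ : _ = k e y - K 0 t0 * e - k 0 y); last by ring.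
    apply: H => // s; rewrite subr0 => sr; have [_ d1 b1 _] := box s y sr yr.
      have d3 : is_derive s 1 ((K 0 t0) \*: @id R) (K 0 t0).
        by apply: is_derive_eq; rewrite /GRing.scale /= mulr1.
      exact: is_deriveB d1 d3.
    by [].
  have := @mean_value_bound R g _ t0 r _ dg bg x xr.
  by apply: le_trans; rewrite /g le_eqVlt; apply/orP; left; apply/eqP;
    congr (`| _ |); ring.
have t0r : `|t0 - t0| < r by rewrite subrr normr0.
have [_ _ _ h0] := box 0 t0 ltac:(by rewrite normr0) t0r.
near=> d.
have d0 : d != 0 by near: d; exact: nbhs_dnbhs_neq.
have dr : `|d| < r by near: d; exact: dnbhs0_lt.
have xr : `|d *: 1 + t0 - t0| < r by rewrite addrK [_ *: _]mulr1.
have [_ _ _ hx] := box 0 (d *: 1 + t0) ltac:(by rewrite normr0) xr.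
set x := d *: 1 + t0 in xr hx *.
have xE : x - t0 = d by rewrite /x addrK [_ *: _]mulr1.
have dh_quot : is_derive (0 : R) 1 (N^~ x - N^~ t0) (h x - h t0).
  exact: is_deriveB.
suff bound : `|d * K 0 t0 - (h x - h t0)| <= eta * `|d|.
  rewrite -(@ler_pM2r _ `|d|) ?normr_gt0// -normrM mulrBl.
  rewrite [_ *: _]mulrC mulfVK// [_ * d in X in `|X|]mulrC //.
(* [bound] is [second_difference e x] divided by [e], in the limit where [e],
   called [s] below, tends to 0. *)
have [/cvg_ex[/= l dql] /esym dqE] := dh_quot.
have {dqE} lE : h x - h t0 = l by rewrite dqE; exact/cvg_lim.
rewrite {}lE.
have lim_quot : (fun s => `|d * K 0 t0 - s^-1 *:
    ((N^~ x - N^~ t0) (s *: 1 + 0) - (N^~ x - N^~ t0) 0)|) @ 0^' -->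
    `|d * K 0 t0 - l|.
  by apply: cvg_norm; apply: cvgB => //; exact: cvg_cst.
apply: (cvgr_to_le lim_quot); near=> s.
have s0 : s != 0 by near: s; exact: nbhs_dnbhs_neq.
have sr : `|s| < r by near: s; exact: dnbhs0_lt.
have sdx := second_difference s x sr xr.
rewrite xE in sdx.
rewrite -(@ler_pM2r _ `|s|) ?normr_gt0// -normrM mulrBl.
have scaleVK X : (s^-1 *: X : R) * s = X by rewrite [_ *: _]mulrC mulfVK.
rewrite {}scaleVK !addr0 [s *: 1]mulr1.
rewrite distrC mulrAC [leRHS]mulrAC; congr (`|_| <= _): sdx.
by rewrite !fctE; ring.
Unshelve. all: by end_near. Qed.

(** * Continuous differentiability at a point *)

(** Joint continuity of [(y, v) |-> 'd f y v] is continuity of the differential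
    in operator norm when the source is finite-dimensional. In this form, the
    stability under composition is that of continuous functions, without any
    choice of basis. *)
Definition C1_at {R : realType} {V W : normedModType R} (f : V -> W) (x : V) :=
  (\forall y \near x, differentiable f y) /\
  forall v, {for (x, v), continuous (fun p : V * V => 'd f (p.1) p.2)}.

Section C1.
Context {R : realType}.
Implicit Types U V W : normedModType R.

Lemma C1_at_differentiable V W (f : V -> W) x : C1_at f x -> differentiable f x.
Proof. by move=> [/nbhs_singleton]. Qed.

Lemma C1_at_continuous V W (f : V -> W) x : C1_at f x -> {for x, continuous f}.
Proof. by move=> /C1_at_differentiable/differentiable_continuous. Qed.

Lemma C1_at_derive_continuous V W (f : V -> W) x v :
  C1_at f x -> {for x, continuous (fun y => 'D_v f y)}.
Proof.
move=> [df /(_ v) cf]; rewrite /prop_for /continuous_at.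
rewrite deriveE; last exact: nbhs_singleton df.
have : 'd f y v @[y --> x] --> 'd f x v.
  have slice : (y, v) @[y --> x] --> (x, v).
    by apply: cvg_pair => /=; [exact: cvg_id|exact: cvg_cst].
  exact: cvg_comp slice cf.
apply: cvg_trans; apply: near_eq_cvg.
by apply: filterS df => y dfy; rewrite deriveE.
Qed.

Let fst_at V W (x : V) (v : W) : (@fst V W) @ nbhs (x, v) --> x.
Proof. by apply: (@cvg_fst _ _ (nbhs x) (nbhs v)). Qed.

Let snd_at V W (x : V) (v : W) : (@snd V W) @ nbhs (x, v) --> v.
Proof. by apply: (@cvg_snd _ _ (nbhs x) (nbhs v)). Qed.

Let near_fst V W (x : V) (v : W) (P : V -> Prop) :
  (\forall y \near x, P y) -> \forall p \near (x, v), P p.1.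
Proof. exact: fst_at. Qed.

Lemma C1_at_comp U V W (f : U -> V) (g : V -> W) x :
  C1_at f x -> C1_at g (f x) -> C1_at (g \o f) x.
Proof.
move=> cf cg; have fx := C1_at_continuous cf.
case: cf cg => df cf [dg cg].
have dgf : \forall y \near x, differentiable g (f y) by exact: (fx _ dg).
split=> [|v].
  by apply: filterS2 df dgf => y; exact: differentiable_comp.
have dfx := nbhs_singleton df; have dgx := nbhs_singleton dg.
rewrite /prop_for /continuous_at /= diff_comp//.
have : 'd g (f p.1) ('d f (p.1) p.2) @[p --> (x, v)] --> 'd g (f x) ('d f x v).
  have fst_snd : (f p.1, 'd f (p.1) p.2) @[p --> (x, v)] --> (f x, 'd f x v).
    apply: cvg_pair; last exact: cf.
    exact: cvg_comp (@fst_at _ _ x v) fx.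
  exact: cvg_comp fst_snd (cg _).
apply: cvg_trans; apply: near_eq_cvg.
apply: filterS2 (near_fst v df) (near_fst v dgf) => p ? ?.
by rewrite [RHS]/= [in RHS]diff_comp.
Qed.

Lemma C1_at_pair U V W (f : U -> V) (g : U -> W) x :
  C1_at f x -> C1_at g x -> C1_at (fun y => (f y, g y)) x.
Proof.
move=> [df cf] [dg cg]; split=> [|v].
  by apply: filterS2 df dg => y; exact: differentiable_pair.
have dfx := nbhs_singleton df; have dgx := nbhs_singleton dg.
rewrite /prop_for /continuous_at /= diff_pair//.
have : ('d f (p.1) p.2, 'd g (p.1) p.2) @[p --> (x, v)] --> ('d f x v, 'd g x v).
  by apply: cvg_pair; [exact: cf|exact: cg].
apply: cvg_trans; apply: near_eq_cvg.
apply: filterS2 (near_fst v df) (near_fst v dg) => p ? ?.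
by rewrite [in RHS]diff_pair.
Qed.

Lemma C1_at_linear V W (f : {linear V -> W}) x : continuous f -> C1_at f x.
Proof.
move=> cf; split=> [|v].
  by apply: nearW => y; exact: linear_differentiable.
rewrite (_ : (fun p => _) = (f : V -> W) \o (@snd V V)); last first.
  by apply/funext => p; rewrite diff_lin.
exact: cvg_comp (@snd_at _ _ x v) (cf v).
Qed.

Lemma C1_at_fst V W (p : V * W) : C1_at (@fst V W) p.
Proof. by apply: (@C1_at_linear _ _ (@fst V W)) => -[]; exact: fst_at. Qed.

Lemma C1_at_snd V W (p : V * W) : C1_at (@snd V W) p.
Proof. by apply: (@C1_at_linear _ _ (@snd V W)) => -[]; exact: snd_at. Qed.

Lemma C1_at_mul V (f g : V -> R) x : C1_at f x -> C1_at g x -> C1_at (f * g) x.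
Proof.
move=> cf cg; have fx := C1_at_continuous cf.
have gx := C1_at_continuous cg.
case: cf cg => df cf [dg cg]; split=> [|v].
  by apply: filterS2 df dg => y; exact: differentiableM.
have dfx := nbhs_singleton df; have dgx := nbhs_singleton dg.
rewrite /prop_for /continuous_at /= diffM//.
have : f p.1 * 'd g (p.1) p.2 + g p.1 * 'd f (p.1) p.2 @[p --> (x, v)]
    --> f x * 'd g x v + g x * 'd f x v.
  apply: cvgD; apply: cvgM; [|exact: cg| |exact: cf].
  - exact: cvg_comp (@fst_at _ _ x v) fx.
  - exact: cvg_comp (@fst_at _ _ x v) gx.
apply: cvg_trans; apply: near_eq_cvg.
apply: filterS2 (near_fst v df) (near_fst v dg) => p ? ?.
by rewrite [in RHS]diffM.
Qed.

(** The directional derivatives along finitely many vectors control the whole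
    differential; the coordinates are kept abstract so as to treat products of
    scalars and row vectors uniformly. *)
Definition finite_coordinates V := exists (J : finType) (b : J -> V)
  (l : J -> V -> R), (forall j, continuous (l j)) /\
  forall v, v = \sum_j l j v *: b j.

Lemma finite_coordinates_scalar : finite_coordinates R.
Proof.
exists unit, (fun=> 1), (fun=> id); split=> [_ x|v]; first exact: cvg_id.
by rewrite (big_pred1 tt) => [|[]//]; rewrite [_ *: _]mulr1.
Qed.

Lemma finite_coordinates_rV n : finite_coordinates 'rV[R]_n.
Proof.
exists 'I_n, (fun i => delta_mx 0 i), (fun i (v : 'rV[R]_n) => v 0 i); split=> [i|v].
  exact: coord_continuous.
exact: row_sum_delta.
Qed.

Lemma finite_coordinates_pair V W : finite_coordinates V ->
  finite_coordinates W -> finite_coordinates (V * W)%type.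
Proof.
move=> [J [b [l [cl vE]]]] [J' [b' [l' [cl' wE]]]].
exists (J + J')%type,
  (fun j => match j with inl i => (b i, 0) | inr i => (0, b' i) end),
  (fun j p => match j with inl i => l i p.1 | inr i => l' i p.2 end).
split=> [[j|j] [p p']|[v w]].
- exact: cvg_comp (@fst_at _ _ p p') (cl j p).
- exact: cvg_comp (@snd_at _ _ p p') (cl' j p').
- rewrite big_sumType/= {1}(vE v) {1}(wE w); apply/pair_equal_spec; split.
  + rewrite !raddf_sum/= [X in _ + X]big1 ?addr0// => j _.
    by rewrite scaler0.
  + rewrite !raddf_sum/= [X in X + _]big1 ?add0r// => j _.
    by rewrite scaler0.
Qed.

(** In coordinates, [f] differentiable at [y] has
    ['d f y v = \sum_j l j v *: 'D_(b j) f y], where both factors are continuous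
    in [(y, v)]. *)
Lemma Ck1_C1_at V W (D : set V) (f : V -> W) x :
  finite_coordinates V -> open D -> D x -> Ck 1 D f -> C1_at f x.
Proof.
move=> [J [b [l [cl vE]]]] oD Dx [df cf].
have nD : \forall y \near x, D y by exact: open_nbhs_nbhs.
have dE y v : D y -> 'd f y v = \sum_j l j v *: 'D_(b j) f y.
  move=> Dy; rewrite {1}(vE v) linear_sum; apply: eq_bigr => j _.
  by rewrite linearZ deriveE//; exact: df.
split=> [|v]; first by apply: filterS nD; exact: df.
rewrite /prop_for /continuous_at /= dE//.
have : \sum_j l j p.2 *: 'D_(b j) f p.1 @[p --> (x, v)]
    --> \sum_j l j v *: 'D_(b j) f x.
  apply: cvg_big; first exact: add_continuous.
  move=> j _; apply: cvgZ.
    exact: cvg_comp (@snd_at _ _ x v) (cl j v).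
  exact: cvg_comp (@fst_at _ _ x v) (cf (b j) x Dx).
apply: cvg_trans; apply: near_eq_cvg.
by apply: filterS (near_fst v nD) => p ?; rewrite dE.
Qed.

Lemma smooth_C1_at V W (D : set V) (f : V -> W) x :
  finite_coordinates V -> open D -> D x -> smooth_on D f -> C1_at f x.
Proof. by move=> fV oD Dx sf; apply: Ck1_C1_at fV oD Dx (sf 1). Qed.

Lemma smooth_derive_C1_at V W (D : set V) (f : V -> W) x v :
  finite_coordinates V -> open D -> D x -> smooth_on D f ->
  C1_at (fun y => 'D_v f y) x.
Proof. by move=> fV oD Dx sf; apply: Ck1_C1_at fV oD Dx (proj2 (sf 2) v). Qed.

End C1.

(** * The fundamental theorem for oriented integrals *)

(** The integral from a base point [c'] to the left of [u] and [v] is a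
    primitive, and the oriented integral is its increment in either order of
    the endpoints. *)
Lemma is_derive_oriented_integral (R : realType) (f : R -> R) (c d u v : R) :
  (forall x, c < x < d -> {for x, continuous f}) -> c < u < d -> c < v < d ->
  is_derive v 1 (fun y => oriented_integral u y f) (f v).
Proof.
move=> cf /andP[cu ud] /andP[cv vd].
pose c' := (c + Num.min u v) / 2; pose d' := (Num.max u v + d) / 2.
have [cc' c'u c'v] : [/\ c < c', c' < u & c' < v].
  by rewrite /c' /Num.min; case: ifP => ?; split; lra.
have [d'd ud' vd'] : [/\ d' < d, u < d' & v < d'].
  by rewrite /d' /Num.max; case: ifP => ?; split; lra.
have intf a b : c < a -> b < d ->
    lebesgue_measure.-integrable `[a, b] (EFin \o f).
  move=> ca bd; apply: continuous_compact_integrable.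
    exact: segment_compact.
  apply: continuous_in_subspaceT => x; rewrite inE/= in_itv/= => /andP[ax xb].
  by apply: cf; rewrite (lt_le_trans ca ax) (le_lt_trans xb bd).
pose P y := \int[lebesgue_measure]_(t in `[c', y]) f t.
have split_integral a b : c' < a -> a <= b -> b < d' ->
    \int[lebesgue_measure]_(t in `[a, b]) f t = P b - P a.
  move=> c'a ab bd'; rewrite /P Rintegral_itvB ?bnd_simp//; last 2 first.
  - exact: intf (lt_trans bd' d'd).
  - exact: ltW.
  rewrite Rintegral_itv_obnd_cbnd//.
  apply: integrableS (intf a b (lt_trans cc' c'a) (lt_trans bd' d'd)) => //.
  exact: subset_itv_oc_cc.
have PE : \forall y \near v, P y - P u = oriented_integral u y f.
  near=> y; rewrite /oriented_integral.
  have c'y : c' < y by near: y; exact: lt_nbhsr.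
  have yd' : y < d' by near: y; exact: lt_nbhsl.
  case: ifPn => [uy|]; first by rewrite split_integral.
  by rewrite -ltNge => /ltW yu; rewrite split_integral// opprB.
apply: near_eq_is_derive PE _.
have [dP P'v] := continuous_FTC1_closed vd' (intf c' d' cc' d'd) c'v
  (cf v ltac:(by rewrite cv)).
have dPv : is_derive v 1 P (f v) by split => //; rewrite -derive1E.
by rewrite -[f v]subr0; exact: is_deriveB dPv (is_derive_cst (P u) v 1).
Unshelve. all: by end_near. Qed.

(** * Partial derivatives and derivatives along curves *)

Section directional.
Context {R : realType}.
Implicit Types U V W : normedModType R.

(** Both sides are limits of the same difference quotient. This identifies the
    derivatives of the slices of [f], as they occur in gradients and along
    trajectories, with directional derivatives of [f] as a function of all its
    variables. *)
Lemma derive_slice U V W (f : V -> W) (g : U -> V) (x u : U) (v : V) :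
  (forall h : R, g (h *: u + x) = h *: v + g x) ->
  'D_u (f \o g) x = 'D_v f (g x).
Proof.
move=> gE; rewrite /derive.
suff -> : (fun h : R => h^-1 *: (((f \o g) \o shift x) (h *: u) - (f \o g) x)) =
    (fun h => h^-1 *: ((f \o shift (g x)) (h *: v) - f (g x))) by [].
by apply/funext => h /=; rewrite gE.
Qed.

Lemma is_derive_chain V W (f : V -> W) (g : R -> V) (x : R) (dg : V) :
  differentiable f (g x) -> is_derive x 1 g dg ->
  is_derive x 1 (f \o g) ('d f (g x) dg).
Proof.
move=> df [/derivable1_diffP gx <-].
have dfg : differentiable (f \o g) x by exact: differentiable_comp.
split; first by apply/derivable1_diffP.
by rewrite !deriveE// [in LHS]diff_comp.
Qed.

Lemma is_derive_coord m n (M : R -> 'M[R]_(m, n)) (x : R) (dM : 'M[R]_(m, n))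
    i j :
  is_derive x 1 M dM -> is_derive x 1 (fun y => M y i j) (dM i j).
Proof.
move=> [Mx <-]; split; first exact: (proj1 (derivable_mxP _ _ _) Mx).
by rewrite derive_mx// mxE.
Qed.

Lemma is_derive_pair V W (f : R -> V) (g : R -> W) (x : R) (df : V) (dg : W) :
  is_derive x 1 f df -> is_derive x 1 g dg ->
  is_derive x 1 (fun y => (f y, g y)) (df, dg).
Proof.
move=> [/derivable1_diffP fx <-] [/derivable1_diffP gx <-].
have dfg : differentiable (fun y => (f y, g y)) x by exact: differentiable_pair.
split; first by apply/derivable1_diffP.
by rewrite !deriveE// diff_pair.
Qed.

Lemma derive_first W (f : R -> R -> W) e t :
  'D_(1, 0) (fun z : R * R => f z.1 z.2) (e, t) = derive1 (f^~ t) e.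
Proof.
rewrite derive1E; apply/esym.
apply: (@derive_slice _ _ _ (fun z : R * R => f z.1 z.2) (fun y => (y, t))).
by move=> h; apply/pair_equal_spec; split => /=; rewrite ?scaler0 ?add0r.
Qed.

Lemma derive_second W (f : R -> R -> W) e t :
  'D_(0, 1) (fun z : R * R => f z.1 z.2) (e, t) = derive1 (f e) t.
Proof.
rewrite derive1E; apply/esym.
apply: (@derive_slice _ _ _ (fun z : R * R => f z.1 z.2) (fun y => (e, y))).
by move=> h; apply/pair_equal_spec; split => /=; rewrite ?scaler0 ?add0r.
Qed.

Lemma is_derive_first W (f : R * R -> W) e t : differentiable f (e, t) ->
  is_derive e 1 (fun y => f (y, t)) ('D_(1, 0) f (e, t)).
Proof.
move=> df; rewrite deriveE//.
apply: (@is_derive_chain _ _ f (fun y => (y, t))) => //.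
exact: is_derive_pair.
Qed.

Lemma is_derive_second W (f : R * R -> W) e t : differentiable f (e, t) ->
  is_derive t 1 (fun y => f (e, y)) ('D_(0, 1) f (e, t)).
Proof.
move=> df; rewrite deriveE//.
apply: (@is_derive_chain _ _ f (fun y => (e, y))) => //.
exact: is_derive_pair.
Qed.

Lemma is_derive_unique W (f : R -> W) (x : R) (a b : W) :
  is_derive x 1 f a -> is_derive x 1 f b -> a = b.
Proof. by move=> [_ <-] [_ <-]. Qed.

Lemma near_slice (P : R * R -> Prop) (e t : R) :
  (\forall z \near (e, t), P z) -> \forall s \near t, P (e, s).
Proof.
move=> nP.
have slice : (e, s) @[s --> t] --> (e, t).
  exact: cvg_pair (cvg_cst (e : R)) (@cvg_id _ (nbhs t)).
exact: (slice _ nP).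
Qed.

(** The function [phi] stands for a continuous linear functional: the identity
    for a scalar [f], a coordinate for a vector-valued one, since
    [derive_along_mixed] relies on the mean value theorem for scalar
    functions. *)
Lemma is_derive_mixed_partials W (phi : W -> R) (f : R * R -> W) (t0 : R) :
  continuous phi ->
  (forall (g : R -> W) (x : R) (dg : W),
    is_derive x 1 g dg -> is_derive x 1 (fun y => phi (g y)) (phi dg)) ->
  C1_at f (0, t0) -> C1_at (fun z => 'D_(0, 1) f z) (0, t0) ->
  is_derive t0 1 (fun t => phi ('D_(1, 0) f (0, t)))
    (phi ('D_(1, 0) (fun z => 'D_(0, 1) f z) (0, t0))).
Proof.
move=> cphi dphi cf cf2.
apply: (@derive_along_mixed R (fun e t => phi (f (e, t)))
  (fun e t => phi ('D_(0, 1) f (e, t)))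
  (fun e t => phi ('D_(1, 0) (fun z => 'D_(0, 1) f z) (e, t)))
  (fun t => phi ('D_(1, 0) f (0, t))) t0).
- case: cf => df _; apply: filterS df => -[e t] dft.
  exact/dphi/is_derive_second.
- case: cf2 => df _; apply: filterS df => -[e t] dft.
  by apply: dphi; exact: (@is_derive_first _ (fun z => 'D_(0, 1) f z)).
- have -> : (fun z : R * R =>
      phi ('D_(1, 0) (fun z => 'D_(0, 1) f z) (z.1, z.2))) =
      phi \o (fun z => 'D_(1, 0) (fun z => 'D_(0, 1) f z) z).
    by apply/funext => -[].
  apply: continuous_comp; last exact: cphi.
  exact: (@C1_at_derive_continuous _ _ _ (fun z => 'D_(0, 1) f z)).
- case: cf => df _; apply: filterS (near_slice df) => t dft.
  by apply: dphi; exact: (@is_derive_first _ f).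
Qed.

Lemma is_derive_dotr n (u v : R -> 'rV[R]_n) (x : R) (du dv : 'rV[R]_n) :
  is_derive x 1 u du -> (forall i, is_derive x 1 (fun y => v y 0 i) (dv 0 i)) ->
  is_derive x 1 (fun y => dotr (u y) (v y)) (dotr du (v x) + dotr (u x) dv).
Proof.
move=> xu xv.
have prod i : is_derive x 1 (fun y => u y 0 i * v y 0 i)
    (du 0 i * v x 0 i + u x 0 i * dv 0 i).
  have := is_deriveM (is_derive_coord 0 i xu) (xv i).
  by rewrite addrC /GRing.scale/= [v x 0 i * _]mulrC.
have -> : (fun y => dotr (u y) (v y)) = \sum_(i < n) (fun y => u y 0 i * v y 0 i).
  by apply/funext => y; rewrite fct_sumE.
rewrite /dotr -big_split/=.
exact: is_derive_sum.
Qed.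

Lemma diff_partials W (f : R * R -> W) z (a b : R) : differentiable f z ->
  'd f z (a, b) = a *: 'D_(1, 0) f z + b *: 'D_(0, 1) f z.
Proof.
move=> df; rewrite !deriveE// -!linearZ -linearD; congr ('d f z _).
by apply/pair_equal_spec; split => /=;
  rewrite scaler0 ?addr0 ?add0r; rewrite [RHS]mulr1.
Qed.

End directional.

(** * From the invariance of the action to a pointwise identity *)

(** [derive_along_mixed] is applied to the action as a function of [e] and of
    the final time [x]. Its derivative in [e] at 0 is the zero function, whose
    derivative at [t0] is thus the mixed derivative of the action, namely the
    derivative in [e] of the transported integrand [k]; the left-hand side
    expands the latter by the chain rule, using [d_s T (0, t0) = 1]. *)
Lemma invariance_density (R : realType) (F T : R * R -> R) (t0 : R) :
  C1_at F (0, t0) -> C1_at T (0, t0) ->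
  C1_at (fun z => 'D_(0, 1) T z) (0, t0) ->
  (\forall t \near t0, T (0, t) = t) ->
  (\forall x \near t0, is_derive (0 : R) 1 (fun e =>
     oriented_integral (T (e, t0)) (T (e, x)) (fun s => F (e, s))) 0) ->
  'D_(1, 0) F (0, t0) + 'D_(0, 1) F (0, t0) * 'D_(1, 0) T (0, t0)
    + F (0, t0) * 'D_(1, 0) (fun z => 'D_(0, 1) T z) (0, t0) = 0.
Proof.
move=> cF cT cS T0 dA.
pose S z := 'D_(0, 1) T z.
have dT := C1_at_differentiable cT.
have dS := C1_at_differentiable cS.
have dF := C1_at_differentiable cF.
have T00 : T (0, t0) = t0 by exact: nbhs_singleton T0.
have S00 : S (0, t0) = 1.
  have dT0 : is_derive t0 1 (fun t => T (0, t)) (S (0, t0)).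
    exact: is_derive_second.
  apply: is_derive_unique dT0 _.
  have idT : \forall t \near t0, t = T (0, t) by apply: filterS T0 => t ->.
  exact: near_eq_is_derive idT (is_derive_id t0 1).
pose r (z : R * R) := (z.1, T z).
have cr : C1_at r (0, t0) by exact: C1_at_pair (@C1_at_fst _ _ _ _) cT.
have r0 : r (0, t0) = (0, t0) by rewrite /r T00.
pose k : R * R -> R := (F \o r) * S.
have cFr : C1_at (F \o r) (0, t0) by apply: (C1_at_comp cr); rewrite r0; exact: cF.
have ck : C1_at k (0, t0) by exact: C1_at_mul cFr cS.
have k0 : 'D_(1, 0) k (0, t0) = 0.
  suff dcst : is_derive t0 1 (cst 0 : R -> R) ('D_(1, 0) k (0, t0)).
    exact: is_derive_unique dcst (is_derive_cst 0 t0 1).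
  apply: (@derive_along_mixed R
    (fun e x => oriented_integral (T (e, t0)) (T (e, x)) (fun s => F (e, s)))
    (fun e x => k (e, x)) (fun e x => 'D_(1, 0) k (e, x)) (cst 0) t0 _ _ _ dA).
  (* In a box of radius [rho] around [(0, t0)] the integrand is continuous in
     time, and for [(e, x)] close to [(0, t0)] both endpoints stay in the
     interval of radius [rho] around [t0]. *)
  - have [/nbhs_ballP[rho /= rho0 box] _] := cF.
    have Tnear : \forall z \near (0, t0), t0 - rho < T z < t0 + rho.
      have cT0 := C1_at_continuous cT.
      move/cvgrPdist_lt : cT0 => /(_ _ rho0); apply: filterS => z.
      by rewrite T00 ltr_norml; lra.
    have Tnear0 : \forall z \near ((0 : R), t0), t0 - rho < T (z.1, t0) < t0 + rho.
      have to_axis : (z.1, t0) @[z --> ((0 : R), t0)] --> ((0 : R), t0).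
        exact: cvg_pair (@cvg_fst _ _ (nbhs (0 : R)) (nbhs t0) _) (cvg_cst t0).
      exact: (to_axis _ Tnear).
    have enear : \forall z \near ((0 : R), t0), `|z.1| < rho.
      have near0 : \forall e \near (0 : R), `|e| < rho by exact: nbhs0_lt.
      exact: (@cvg_fst _ _ (nbhs (0 : R)) (nbhs t0) _ _ near0).
    have ndT := cT.1.
    change (\forall z \near ((0 : R), t0), is_derive (z.2 : R) 1
      (fun x => oriented_integral (T (z.1, t0)) (T (z.1, x))
         (fun s => F (z.1, s))) (k (z.1, z.2))).
    near=> z.
    have dTz : is_derive z.2 1 (fun x => T (z.1, x)) (S (z.1, z.2)).
      by apply: is_derive_second; rewrite -surjective_pairing; near: z.
    have Tz : t0 - rho < T (z.1, z.2) < t0 + rho.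
      by rewrite -surjective_pairing; near: z.
    have Tz0 : t0 - rho < T (z.1, t0) < t0 + rho by near: z.
    have ez : `|z.1| < rho by near: z.
    have cFz x : t0 - rho < x < t0 + rho ->
        {for x, continuous (fun s => F (z.1, s))}.
      move=> xr; apply: differentiable_continuous.
      apply/derivable1_diffP.
      have dFx : differentiable F (z.1, x).
        apply: box; split; rewrite /ball/= ?sub0r ?normrN// distrC ltr_norml.
        by move: xr; lra.
      by have [] := is_derive_second dFx.
    have dint := is_derive_oriented_integral cFz Tz0 Tz.
    exact: (@is_derive1_comp _ _ (fun x => T (z.1, x)) _ _ _ dint dTz).
  - case: ck => dk _; apply: filterS dk => -[e x].
    exact: (@is_derive_first _ _ k).
  - have -> : (fun z : R * R => 'D_(1, 0) k (z.1, z.2)) =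
        (fun z => 'D_(1, 0) k z) by apply/funext => -[].
    exact: C1_at_derive_continuous.
apply: etrans k0.
set lhs := LHS.
suff dlhs : is_derive (0 : R) 1 (fun e => k (e, t0)) lhs.
  have dk := is_derive_first (C1_at_differentiable ck).
  exact: is_derive_unique dlhs dk.
have dFr : is_derive (0 : R) 1 (fun e => F (e, T (e, t0)))
    ('D_(1, 0) F (0, t0) + 'D_(0, 1) F (0, t0) * 'D_(1, 0) T (0, t0)).
  have -> : 'D_(1, 0) F (0, t0) + 'D_(0, 1) F (0, t0) * 'D_(1, 0) T (0, t0)
      = 'd F (0, T (0, t0)) (1, 'D_(1, 0) T (0, t0)).
    by rewrite T00 diff_partials// scale1r [_ *: _]mulrC.
  apply: (@is_derive_chain _ _ _ F (fun e => (e, T (e, t0)))).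
    by rewrite T00.
  exact: is_derive_pair (is_derive_id (0 : R) 1)
    (is_derive_first dT).
have := is_deriveM dFr (is_derive_first dS).
by rewrite -/(S (0, t0)) S00 T00 scale1r addrC /lhs.
Unshelve. all: by end_near. Qed.

(** * The conserved quantity *)

Lemma diff_gradient (R : realType) n (f : 'rV[R]_n -> R) (x y : 'rV[R]_n) :
  differentiable f x -> 'd f x y = dotr (gradient f x) y.
Proof.
move=> df; rewrite {1}(row_sum_delta y) linear_sum; apply: eq_bigr => i _.
by rewrite linearZ mxE deriveE// mulrC.
Qed.

Lemma diff_lagrangian (R : realType) n (L : R -> 'rV[R]_n -> 'rV[R]_n -> R)
    (t : R) (x v y w : 'rV[R]_n) :
  let Lz := fun z : R * 'rV[R]_n * 'rV[R]_n => L z.1.1 z.1.2 z.2 in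
  differentiable Lz (t, x, v) ->
  'd Lz (t, x, v) (0, y, w) =
    dotr (grad_pos L t x v) y + dotr (grad_vel L t x v) w.
Proof.
move=> Lz dL.
have posE : 'd Lz (t, x, v) (0, y, 0) = dotr (grad_pos L t x v) y.
  have dpos : differentiable (fun y => L t y v) x.
    apply: (@differentiable_comp _ _ _ _ (fun y => (t, y, v)) Lz);
      last exact: dL.
    by apply: differentiable_pair => //; exact: differentiable_pair.
  rewrite -diff_gradient// -!deriveE//; apply/esym.
  apply: (@derive_slice _ _ _ _ Lz (fun y => (t, y, v))) => h.
  by apply/pair_equal_spec; split; [apply/pair_equal_spec; split|];
    rewrite /= ?scaler0 ?add0r.
have velE : 'd Lz (t, x, v) (0, 0, w) = dotr (grad_vel L t x v) w.
  have dvel : differentiable (fun w => L t x w) v.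
    apply: (@differentiable_comp _ _ _ _ (fun w => (t, x, w)) Lz);
      last exact: dL.
    exact: (@differentiable_pair _ _ _ _ (cst (t, x)) id).
  rewrite -diff_gradient// -!deriveE//; apply/esym.
  apply: (@derive_slice _ _ _ _ Lz (fun w => (t, x, w))) => h.
  by apply/pair_equal_spec; split; [apply/pair_equal_spec; split|];
    rewrite /= ?scaler0 ?add0r.
rewrite -posE -velE -linearD; congr ('d Lz _ _).
by apply/pair_equal_spec; split; [apply/pair_equal_spec; split|];
  rewrite /= ?addr0 ?add0r.
Qed.

Unset Implicit Arguments.

Theorem theorem5 (R : realType) (n : nat) (hn : (1 <= n)%N)
    (U : set (R * 'rV[R]_n * 'rV[R]_n))
    (L : R -> 'rV[R]_n -> 'rV[R]_n -> R)
    (I : set R) (q : R -> 'rV[R]_n)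
    (Q : R -> R -> 'rV[R]_n) (tau : R -> R -> R)
    (hL : is_lagrangian U L)
    (hI : open_interval I)
    (hq : is_trajectory U I q)
    (hQ : space_change I q Q)
    (htau : time_change I tau)
    (hinv : infinitesimal_invariance L I Q tau)
    (hlag : lagrange_solution L I q) :
  exists c : R, forall t, I t ->
    dotr (grad_vel L t (q t) (derive1 q t)) (derive1 (fun e => Q e t) 0)
      + L t (q t) (derive1 q t) * derive1 (fun e => tau e t) 0 = c.
Proof.
move: hL hI hq hQ htau => [oU sL] [oI itvI] [_ qU] [[DQ [oDQ DQ0 _ sQ]] Q0]
  [[DT [oDT DT0 _ sT]] tau0].
apply: constant_of_derive0 itvI _ => t0 It0.
have nI : \forall t \near t0, I t by exact: open_nbhs_nbhs.
have fc2 : finite_coordinates (R * R)%type.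
  by apply: finite_coordinates_pair; exact: finite_coordinates_scalar.
have fcU : finite_coordinates (R * 'rV[R]_n * 'rV[R]_n)%type.
  apply: finite_coordinates_pair (finite_coordinates_rV n).
  exact: finite_coordinates_pair finite_coordinates_scalar
    (finite_coordinates_rV n).
pose Qz (z : R * R) := Q z.1 z.2.
pose V z := 'D_(0, 1) Qz z.
pose T (z : R * R) := tau z.1 z.2.
pose S z := 'D_(0, 1) T z.
have cQ : C1_at Qz (0, t0) by exact: smooth_C1_at fc2 oDQ (DQ0 _ It0) sQ.
have cV : C1_at V (0, t0).
  exact: smooth_derive_C1_at fc2 oDQ (DQ0 _ It0) sQ.
have cT : C1_at T (0, t0) by exact: smooth_C1_at fc2 oDT (DT0 _ It0) sT.
have cS : C1_at S (0, t0).
  exact: smooth_derive_C1_at fc2 oDT (DT0 _ It0) sT.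
have VE e s : V (e, s) = derive1 (Q e) s by exact: derive_second.
have V0 t : I t -> V (0, t) = derive1 q t.
  move=> It; rewrite VE !derive1E; apply: near_eq_derive.
  by have := open_nbhs_nbhs (conj oI It); apply: filterS => s; exact: Q0.
pose Lz (z : R * 'rV[R]_n * 'rV[R]_n) := L z.1.1 z.1.2 z.2.
(* The phase-space point reached by [Q e] at time [s]; [Lz \o P] is the
   integrand of the action. *)
pose P (z : R * R) := (z.2, Qz z, V z).
have P0 t : I t -> P (0, t) = (t, q t, derive1 q t).
  by move=> It; rewrite /P /Qz/= Q0// V0.
have cL : C1_at Lz (P (0, t0)).
  by apply: smooth_C1_at fcU oU _ sL; rewrite P0//; exact: qU.
have cP : C1_at P (0, t0).
  exact: C1_at_pair (C1_at_pair (@C1_at_snd _ _ _ _) cQ) cV.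
have cF : C1_at (Lz \o P) (0, t0) by exact: C1_at_comp cP cL.
have balance := invariance_density cF cT cS.
have {balance} : 'D_(1, 0) (Lz \o P) (0, t0)
    + 'D_(0, 1) (Lz \o P) (0, t0) * 'D_(1, 0) T (0, t0)
    + (Lz \o P) (0, t0) * 'D_(1, 0) S (0, t0) = 0.
  apply: balance.
    by apply: filterS nI => t; exact: tau0.
  apply: filterS nI => x Ix.
  have -> : (fun e => oriented_integral (T (e, t0)) (T (e, x))
      (fun s => (Lz \o P) (e, s))) =
      (fun e => action L (tau e t0) (tau e x) (Q e)).
    apply/funext => e; congr (oriented_integral _ _ _); apply/funext => s.
    by rewrite /Lz /P /= VE.
  exact: hinv.
have dQ := C1_at_differentiable cQ.
have dV := C1_at_differentiable cV.
have dL := C1_at_differentiable cL.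
have dF := C1_at_differentiable cF.
set p := fun t => grad_vel L t (q t) (derive1 q t).
set force := grad_pos L t0 (q t0) (derive1 q t0).
have -> : 'D_(1, 0) (Lz \o P) (0, t0) =
    dotr force ('D_(1, 0) Qz (0, t0)) + dotr (p t0) ('D_(1, 0) V (0, t0)).
  have dF1 := is_derive_first dF.
  apply: is_derive_unique dF1 _.
  rewrite /p /force -diff_lagrangian -P0//.
  apply: (@is_derive_chain _ _ _ Lz (fun e => P (e, t0)) 0 _ dL).
  apply: is_derive_pair (is_derive_first dV).
  exact: is_derive_pair (is_derive_cst t0 _ _) (is_derive_first dQ).
have dl : is_derive t0 1 (fun t => L t (q t) (derive1 q t))
    ('D_(0, 1) (Lz \o P) (0, t0)).
  apply: near_eq_is_derive (is_derive_second dF).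
  by apply: filterS nI => t It /=; rewrite P0.
(* The Lagrange equation only gives the value of the derivative of [p]; that
   [p] is derivable comes from the smoothness of the Lagrangian. *)
have dp : is_derive t0 1 p force.
  have pE i : \forall t \near t0,
      'D_(0, 0, delta_mx 0 i) Lz (P (0, t)) = p t 0 i.
    apply: filterS nI => t It; rewrite P0// mxE; apply/esym.
    apply: (@derive_slice _ _ _ _ Lz (fun w => (t, q t, w))) => h.
    by apply/pair_equal_spec; split; [apply/pair_equal_spec; split|];
      rewrite /= ?scaler0 ?add0r.
  have dp : derivable p t0 1.
    apply/derivable_mxP => j i; rewrite ord1.
    apply: near_eq_derivable (pE i) _.
    have cG : C1_at (fun z => 'D_(0, 0, delta_mx 0 i) Lz z) (P (0, t0)).
      apply: smooth_derive_C1_at fcU oU _ sL; rewrite P0//; exact: qU.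
    have dGP := C1_at_differentiable (C1_at_comp cP cG).
    by have [] := is_derive_second dGP.
  by split => //; apply/eqP; rewrite -subr_eq0 -derive1E; apply/eqP; exact: hlag.
have deta i : is_derive t0 1 (fun t => derive1 (fun e => Q e t) 0 0 i)
    ('D_(1, 0) V (0, t0) 0 i).
  have etaE : (fun t => derive1 (fun e => Q e t) 0 0 i) =
      (fun t => 'D_(1, 0) Qz (0, t) 0 i).
    by apply/funext => t; rewrite (derive_first Q).
  rewrite etaE.
  apply: (@is_derive_mixed_partials _ _ (fun v : 'rV[R]_n => v 0 i) Qz t0 _ _ cQ cV).
    exact: coord_continuous.
  by move=> g x dg; exact: is_derive_coord.
have dtheta : is_derive t0 1 (fun t => derive1 (fun e => tau e t) 0)
    ('D_(1, 0) S (0, t0)).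
  have thetaE : (fun t => derive1 (fun e => tau e t) 0) =
      (fun t => 'D_(1, 0) T (0, t)).
    by apply/funext => t; rewrite (derive_first tau).
  rewrite thetaE.
  exact: (@is_derive_mixed_partials _ _ id T t0 (fun x => cvg_id) (fun _ _ _ => id) cT cS).
move=> balance.
have dnoether := is_deriveD (is_derive_dotr dp deta)
  (is_deriveM dl dtheta).
apply: is_derive_eq dnoether _.
apply: etrans balance; rewrite /= P0//.
rewrite -(derive_first Q) -(derive_first tau) -/Qz -/T.
rewrite /GRing.scale/= /Lz/=.
ring.
Qed.
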